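(* Let $\mathring{X}$ be a labeled random finite set on $\mathbb{X}\times\mathbb{L}$ with generalized labeled multi-Bernoulli (GLMB) density $$\mathring{f}(\mathring{X})=\Delta(\mathring{X})\sum_{\xi\in\Xi}w^{(\xi)}(\mathcal{L}(\mathring{X}))\,[p^{(\xi)}]^{\mathring{X}},$$ where each $p^{(\xi)}(\cdot,\ell)$ is a probability density on $\mathbb{X}$ and the weights $w^{(\xi)}(I)$ are non-negative with $\sum_{(I,\xi)\in\mathcal{F}(\mathbb{L})\times\Xi}w^{(\xi)}(I)=1$. Then the cardinality of objects inside the bounded field-of-view $\mathcal{S}$ is distributed according to $$\rho_{\mathcal{S}}(n)=\sum_{(\xi,\,\mathcal{I}_1\uplus\mathcal{I}_2)\in\Xi\times\mathcal{F}(\mathbb{L})}w^{(\xi)}(\mathcal{I}_1\uplus\mathcal{I}_2)\,\delta_n(|\mathcal{I}_1|)\prod_{\ell\in\mathcal{I}_1}\langle 1_{\mathcal{S}},p^{(\xi,\ell)}\rangle\prod_{\ell\in\mathcal{I}_2}\langle 1-1_{\mathcal{S}},p^{(\xi,\ell)}\rangle,\qquad n=0,1,2,\dots,$$ where the sum is over all $\xi\in\Xi$ and all ordered pairs $(\mathcal{I}_1,\mathcal{I}_2)$ of disjoint (possibly empty) finite subsets of $\mathbb{L}$, and $p^{(\xi,\ell)}(\boldsymbol{x})=p^{(\xi)}(\boldsymbol{x},\ell)$.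
   Context: $\mathbb{X}$ is the single-object (Euclidean) state space and $\mathbb{X}_{\mathrm p}$ is a subspace of it. The field-of-view (FoV) is a compact subset $\mathcal{S}\subset\mathbb{X}_{\mathrm p}$. For $\boldsymbol{x}\in\mathbb{X}$ write $\boldsymbol{x}_{\mathrm p}=\mathrm{proj}_{\mathbb{X}_{\mathrm p}}\boldsymbol{x}$. The generalized indicator is $1_{\mathcal{S}}(\boldsymbol{x})=1$ if $\boldsymbol{x}_{\mathrm p}\in\mathcal{S}$ and $0$ otherwise; for a labeled state $\mathring{x}=(\boldsymbol{x},\ell)$, $1_{\mathcal{S}}(\mathring{x})=1_{\mathcal{S}}(\boldsymbol{x})$. $\mathbb{L}$ is a discrete (countable) label space, $\mathcal{F}(\mathbb{L})$ is the collection of finite subsets of $\mathbb{L}$, and $\Xi$ is a discrete index set (each $\xi\in\Xi$ represents a history of measurement association maps). The label projection is $\mathcal{L}((\boldsymbol{x},\ell))=\ell$, and $\mathcal{L}(\mathring{X})=\{\mathcal{L}(\mathring{x}):\mathring{x}\in\mathring{X}\}$. The distinct label indicator is $\Delta(\mathring{X})=\delta_{|\mathring{X}|}(|\mathcal{L}(\mathring{X})|)$, where $\delta_a(b)=1$ if $a=b$ and $0$ otherwise. Notation: $[h]^{A}=[h(\cdot)]^{A}=\prod_{a\in A}h(a)$ for a finite set $A$, with empty product $1$; $\langle f,g\rangle=\int_{\mathbb{X}} f(\boldsymbol{x})g(\boldsymbol{x})\,\mathrm{d}\boldsymbol{x}$; $\uplus$ denotes disjoint union. FoV cardinality distribution: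 for a finite set $\mathring{X}\subset\mathbb{X}\times\mathbb{L}$, the probability that exactly $n$ objects are inside $\mathcal{S}$ conditioned on $\mathring{X}$ is $$\rho_{\mathcal{S}}(n\,|\,\mathring{X})=\sum_{\mathring{X}^n\subseteq\mathring{X},\ |\mathring{X}^n|=n}[1_{\mathcal{S}}(\cdot)]^{\mathring{X}^n}[1-1_{\mathcal{S}}(\cdot)]^{\mathring{X}\setminus\mathring{X}^n}.$$ For a labeled RFS with density $\mathring{f}$, the FoV cardinality distribution is the set integral $\rho_{\mathcal{S}}(n)=\int\rho_{\mathcal{S}}(n\,|\,\mathring{X})\mathring{f}(\mathring{X})\,\delta\mathring{X}$, that is $$\rho_{\mathcal{S}}(n)=\sum_{m=n}^{\infty}\frac{1}{m!}\sum_{(\ell_1,\dots,\ell_m)\in\mathbb{L}^m}\int_{\mathbb{X}^m}\rho_{\mathcal{S}}(n\,|\,\{(\boldsymbol{x}_1,\ell_1),\dots,(\boldsymbol{x}_m,\ell_m)\})\,\mathring{f}(\{(\boldsymbol{x}_1,\ell_1),\dots,(\boldsymbol{x}_m,\ell_m)\})\,\mathrm{d}\boldsymbol{x}_1\cdots\mathrm{d}\boldsymbol{x}_m.$$ *)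

(* Defs.v *)
From HB Require Import structures.
From mathcomp Require Import all_boot all_order all_algebra finmap.
From mathcomp Require Import all_classical all_reals all_analysis.

Set Implicit Arguments.
Unset Strict Implicit.
Unset Printing Implicit Defensive.

Import Order.TTheory GRing.Theory Num.Theory.
Import numFieldNormedType.Exports.

Local Open Scope classical_set_scope.
Local Open Scope ring_scope.

(* Row vectors carry the product sigma-algebra of their coordinates, exactly as
   the library does for tuples. For T = R this is the Borel sigma-algebra. *)
Definition measure_rV_display : measure_display -> measure_display.
Proof. exact. Qed.

Section measurable_rV.
Context {d} {T : measurableType d}.
Variable n : nat.

Let coors : 'I_n -> 'rV[T]_n -> T := fun i v => v ord0 i.

Let rV_set0 : g_sigma_preimage coors set0.
Proof. exact: sigma_algebra0. Qed.

Let rV_setC A : g_sigma_preimage coors A -> g_sigma_preimage coors (~` A).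
Proof. exact: sigma_algebraC. Qed.

Let rV_bigcup (F : _^nat) : (forall i, g_sigma_preimage coors (F i)) ->
  g_sigma_preimage coors (\bigcup_i (F i)).
Proof. exact: sigma_algebra_bigcup. Qed.

HB.instance Definition _ := @isMeasurable.Build (measure_rV_display d)
  'rV[T]_n (g_sigma_preimage coors) rV_set0 rV_setC rV_bigcup.

Lemma measurable_coord_rV (i : 'I_n) :
  measurable_fun [set: 'rV[T]_n] (fun v => v ord0 i).
Proof.
move=> _ Y mY; rewrite setTI; apply: sub_sigma_algebra => /=.
rewrite -bigcup_seq/=; exists i => /=; first by rewrite mem_index_enum.
by exists Y => //; rewrite setTI.
Qed.

Definition row_of_tuple (t : n.-tuple T) : 'rV[T]_n := \row_i tnth t i.
Definition tuple_of_row (v : 'rV[T]_n) : n.-tuple T :=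
  [tuple v ord0 i | i < n].

Lemma row_of_tupleK : cancel row_of_tuple tuple_of_row.
Proof. by move=> t; apply: eq_from_tnth => i; rewrite tnth_mktuple mxE. Qed.

Lemma measurable_row_of_tuple :
  measurable_fun [set: n.-tuple T] row_of_tuple.
Proof.
move=> _ Y mY; rewrite setTI.
suff : preimage_set_system setT row_of_tuple (g_sigma_preimage coors)
    `<=` measurable by apply; exists Y => //; rewrite setTI.
rewrite -(g_sigma_preimage_comp coors row_of_tuple).
apply: smallest_sub; first exact: sigma_algebra_measurable.
rewrite -bigcup_seq; apply: bigcup_sub => i _ _ [B mB <-].
rewrite (_ : coors i \o row_of_tuple = fun t => tnth t i); last first.
  by apply/funext => t; rewrite /coors /= mxE.
by apply: measurable_tnth.
Qed.

End measurable_rV.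

Lemma measurable_tuple_of_row d (T : measurableType d) n :
  measurable_fun [set: 'rV[T]_n] (@tuple_of_row _ T n).
Proof.
apply/measurable_fun_tnthP => i.
rewrite (_ : _ \o _ = fun v : 'rV[T]_n => v ord0 i); last first.
  by apply/funext => v /=; rewrite tnth_mktuple.
exact: measurable_coord_rV.
Qed.

(* The pushforward of mu along f. The proof arguments are irrelevant to the
   value: they only allow the sigma-finite measure structure to be inferred. *)
Definition spushforward d1 d2 (T1 : measurableType d1) (T2 : measurableType d2)
    (R : realType) (mu : {measure set T1 -> \bar R}) (f : T1 -> T2)
    (g : T2 -> T1) of sigma_finite [set: T1] mu & measurable_fun [set: T1] f
    & measurable_fun [set: T2] g & cancel f g : set T2 -> \bar R :=
  pushforward mu f.

Section spushforward.
Local Open Scope ereal_scope.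
Context d1 d2 (T1 : measurableType d1) (T2 : measurableType d2) (R : realType).
Variables (mu : {measure set T1 -> \bar R}) (f : T1 -> T2) (g : T2 -> T1).
Variables (smu : sigma_finite [set: T1] mu).
Variables (mf : measurable_fun [set: T1] f) (mg : measurable_fun [set: T2] g).
Variable fK : cancel f g.

Local Notation pf := (spushforward smu mf mg fK).

Let pf0 : pf set0 = 0.
Proof. by rewrite /spushforward /pushforward preimage_set0 measure0. Qed.

Let pf_ge0 A : 0 <= pf A.
Proof. exact: measure_ge0. Qed.

Let pf_sigma_additive : semi_sigma_additive pf.
Proof. by apply: measure_semi_sigma_additive. Qed.

HB.instance Definition _ :=
  isMeasure.Build _ _ _ pf pf0 pf_ge0 pf_sigma_additive.

Let pf_sigma_finite : sigma_finite setT pf.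
Proof.
have [F UF Fmu] := smu.
exists (fun n => g @^-1` F n).
  by rewrite -preimage_bigcup -UF preimage_setT.
move=> n; have [mFn Fn_fin] := Fmu n; split.
  by rewrite -[X in measurable X]setTI; exact: mg.
by rewrite /spushforward /pushforward -comp_preimage (_ : g \o f = idfun) //;
  apply/funext => x; rewrite /= fK.
Qed.

HB.instance Definition _ :=
  Measure_isSigmaFinite.Build _ _ _ pf pf_sigma_finite.

End spushforward.

Lemma sigma_finite_prod d1 d2 (T1 : measurableType d1) (T2 : measurableType d2)
    (R : realType) (m1 : {sigma_finite_measure set T1 -> \bar R})
    (m2 : {sigma_finite_measure set T2 -> \bar R}) :
  sigma_finite [set: T1 * T2] (m1 \x m2)%E.
Proof.
have /sigma_finiteP[F [TF ndF Foo]] := sigma_finiteT m1.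
have /sigma_finiteP[G [TG ndG Goo]] := sigma_finiteT m2.
exists (fun n => F n `*` G n).
  rewrite -setXTT TF TG predeqE => -[x y]; split.
    move=> [/= [n _ Fnx] [k _ Gky]]; exists (maxn n k) => //; split.
    - by move: x Fnx; exact/subsetPset/ndF/leq_maxl.
    - by move: y Gky; exact/subsetPset/ndG/leq_maxr.
  by move=> [n _ []/= ? ?]; split; exists n.
move=> k; have [? ?] := Foo k; have [? ?] := Goo k.
split; first exact: measurableX.
by rewrite product_measure1E// lte_mul_pinfty// ge0_fin_numE.
Qed.

Section power_measure.
Context d (T : measurableType d) (R : realType).
Variable mu : {sigma_finite_measure set T -> \bar R}.

Definition tuple_cons n (z : T * n.-tuple T) : n.+1.-tuple T :=
  [tuple of z.1 :: z.2].
Definition tuple_uncons n (t : n.+1.-tuple T) : T * n.-tuple T :=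
  (thead t, [tuple of behead t]).

Lemma tuple_consK n : cancel (@tuple_cons n) (@tuple_uncons n).
Proof. by move=> [x t]; congr (_, _); apply: val_inj. Qed.

Lemma measurable_tuple_cons n : measurable_fun setT (@tuple_cons n).
Proof. by apply: measurable_cons; [exact: measurable_fst|exact: measurable_snd]. Qed.

Lemma measurable_tuple_uncons n : measurable_fun setT (@tuple_uncons n).
Proof.
apply/measurable_fun_pair; last exact: measurable_behead.
exact: measurable_tnth.
Qed.

(* The n-fold product measure of mu on T^n. *)
Fixpoint power_measure n : {sigma_finite_measure set (n.-tuple T) -> \bar R} :=
  if n is n'.+1 return {sigma_finite_measure set (n.-tuple T) -> \bar R}
  then spushforward (sigma_finite_prod mu (power_measure n'))
         (@measurable_tuple_cons n') (@measurable_tuple_uncons n')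
         (@tuple_consK n')
  else \d_([tuple] : 0.-tuple T).

End power_measure.

Definition lebesgue_rV (R : realType) n :
    {sigma_finite_measure set 'rV[R]_n -> \bar R} :=
  spushforward (sigma_finiteT (power_measure (@lebesgue_measure R) n))
    (@measurable_row_of_tuple _ R n) (@measurable_tuple_of_row _ R n)
    (@row_of_tupleK _ R n).

Section orthogonal_projection.
Context {R : realType} {d : nat}.
Implicit Types (U : 'M[R]_d) (v : 'rV[R]_d).

(* A linear subspace of R^d is the row space of U; kermx U^T is its orthogonal
   complement. *)
Definition orthoproj U v : 'rV[R]_d := v *m proj_mx U (kermx U^T).

Let cap_ortho U : (U :&: kermx U^T = 0)%MS.
Proof.
apply/eqP/rowV0P => v; rewrite sub_capmx => /andP[/submxP[a va] /sub_kermxP vU].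
have : v *m v^T = 0 by rewrite [X in X^T]va trmx_mul mulmxA vU mul0mx.
move=> /matrixP/(_ ord0 ord0); rewrite !mxE => /eqP.
rewrite psumr_eq0 => [/allP v0|i _]; last by rewrite mxE -expr2 sqr_ge0.
apply/rowP => i; rewrite mxE; apply/eqP.
by have := v0 i (mem_index_enum i); rewrite mxE mulf_eq0 orbb.
Qed.

Let ortho_full U : row_full (U + kermx U^T)%MS.
Proof.
by rewrite /row_full mxrank_disjoint_sum// mxrank_ker mxrank_tr subnKC// rank_leq_row.
Qed.

Lemma orthoproj_sub U v : (orthoproj U v <= U)%MS.
Proof. exact: proj_mx_sub. Qed.

Lemma orthoproj_ortho U v : (v - orthoproj U v) *m U^T = 0.
Proof.
by apply/sub_kermxP; rewrite proj_mx_compl_sub// submx_full.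
Qed.

End orthogonal_projection.

Section labeled_rfs.
Context {R : realType} {d : nat} {L : countType}.
Local Notation X := 'rV[R]_d.
Implicit Types (A : {fset X * L}) (f g : X -> R).

Definition mexp (T : choiceType) (h : T -> R) (B : {fset T}) : R :=
  \prod_(a <- B) h a.

Definition inner f g : R := \int[lebesgue_rV R d]_x (f x * g x).

Definition is_pdf f : Prop :=
  [/\ measurable_fun [set: X] f, (forall x, 0 <= f x) &
      (\int[lebesgue_rV R d]_x (f x)%:E = 1)%E].

Definition fov_indic (U : 'M[R]_d) (S : set X) (x : X) : R :=
  \1_S (orthoproj U x).

Definition labels A : {fset L} := [fset z.2 | z in A]%fset.

Definition distinct_label A : R := (#|` A| == #|` labels A|)%:R.

(* The sum over xi may diverge at some points, hence the values in \bar R. *)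
Definition glmb_density (Xi : countType) (w : Xi -> {fset L} -> R)
    (p : Xi -> X * L -> R) A : \bar R :=
  ((distinct_label A)%:E *
   \esum_(xi in [set: Xi]) ((w xi (labels A))%:E * (mexp (p xi) A)%:E))%E.

Definition fov_card_cond (one : X -> R) (n : nat) A : R :=
  \sum_(B <- fpowerset A | #|` B| == n)
    mexp (fun z => one z.1) B * mexp (fun z => 1 - one z.1) (A `\` B)%fset.

(* The set {(x_1, l_1), ..., (x_m, l_m)}; repeated pairs collapse. *)
Definition labeled_set m (x : m.-tuple X) (l : m.-tuple L) : {fset X * L} :=
  [fset (tnth x i, tnth l i) | i in 'I_m]%fset.

Definition fov_card (one : X -> R) (f : {fset X * L} -> \bar R) (n : nat) :
    \bar R :=
  (\sum_(n <= m <oo) (m`!%:R^-1)%:E *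
     \esum_(l in [set: m.-tuple L])
       \int[power_measure (lebesgue_rV R d) m]_x
         ((fov_card_cond one n (labeled_set x l))%:E * f (labeled_set x l)))%E.

End labeled_rfs.

(* Main.v *)
(* For fixed labels l_1, ..., l_m the integrand of the set integral factorises
   over the labels. When the labels repeat, the distinct label indicator vanishes
   unless two of the points coincide, which is a null event because d > 0. When
   they are distinct, the sum over B of prod_(B) 1_S prod_(~ B) (1 - 1_S) times
   prod p^(xi) integrates, by Fubini and Tonelli, to a sum over B of products of
   one-object integrals, depending on l only through I = {l_1, ..., l_m}. Each
   such I comes from m! tuples, which cancels 1/m!, and writing (I1, I2) for
   (B, I \ B) yields the formula. *)
Require Import Defs.
From HB Require Import structures.
From mathcomp Require Import all_boot all_order all_algebra finmap.
From mathcomp Require Import all_classical all_reals all_analysis.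
From mathcomp Require Import measurable_realfun.

Set Implicit Arguments.
Unset Strict Implicit.
Unset Printing Implicit Defensive.

Import Order.TTheory GRing.Theory Num.Theory.
Import numFieldNormedType.Exports.

Local Open Scope classical_set_scope.
Local Open Scope ring_scope.

(** * Borel sets and measurable maps for the coordinate sigma-algebra of row vectors *)

Section measurable_rV.
Context {R : realType} {n : nat}.

Lemma measurable_ball_rV (x : 'rV[R]_n) (e : R) : measurable (ball x e).
Proof.
(* A ball of row vectors carries the conjunct [0 < e]. Without this case split the identity below
   would fail for [n = 0], where the empty intersection is everything. *)
have [e0|/negP e0] := boolP (0 < e); last first.
  by rewrite (_ : ball x e = set0)//; apply/seteqP; split=> y // -[].
rewrite (_ : ball x e = \bigcap_(j in [set: 'I_n])
    ((fun v : 'rV[R]_n => v ord0 j) @^-1` ball (x ord0 j) e)); last first.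
  apply/seteqP; split=> [y [_ xy] j _|y xy].
    exact: xy.
  by split=> // i j; rewrite ord1; exact: xy.
apply: fin_bigcap_measurable => [|j _]; first exact: finite_finset.
rewrite -[X in measurable X]setTI.
by apply: measurable_coord_rV => //; rewrite ball_itv; exact: measurable_itv.
Qed.

(* An open set is the union of the balls it contains that have a rational
   centre and a radius 1/(k+1). *)
Lemma open_measurable_rV (U : set 'rV[R]_n) : open U -> measurable U.
Proof.
move=> oU; pose c (q : 'rV[rat]_n) : 'rV[R]_n := map_mx ratr q.
pose D := [set t : 'rV[rat]_n * nat | ball (c t.1) t.2.+1%:R^-1 `<=` U].
rewrite (_ : U = \bigcup_(t in D) ball (c t.1) t.2.+1%:R^-1); last first.
  apply/seteqP; split=> [x Ux|x [t Dt]]; last exact: Dt.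
  have /nbhs_ballP[e /= e0 xeU] : nbhs x U by exact: open_nbhs_nbhs.
  (* Half of [e] is allowed for each of two steps of length [1/(k+1)]: from [x] to the rational
     centre, and from the centre to [y]. *)
  pose k := Num.trunc (2 / e).
  have ke : k.+1%:R^-1 < e / 2.
    rewrite -[e / 2]invrK ltf_pV2 ?posrE ?invr_gt0 ?divr_gt0//.
    by rewrite invf_div /k truncnS_gt.
  have /choice[q xq] (j : 'I_n) :
      exists q : rat, ball (x ord0 j) k.+1%:R^-1 (ratr q).
    have /rat_in_itvoo[q] :
      x ord0 j - k.+1%:R^-1 < x ord0 j + k.+1%:R^-1.
      by rewrite ltrD2l gtrN// invr_gt0.
    by exists q; rewrite ball_itv.
  have qx : ball (c (\row_j q j)) k.+1%:R^-1 x.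
    by split=> [|i j]; rewrite ?invr_gt0// ord1 !mxE; exact: ball_sym.
  exists (\row_j q j, k) => //= y qy; apply: xeU.
  rewrite [e]splitr; apply: (le_ball (ltW _)).
    exact: (ltrD ke ke).
  exact: ball_triangle (ball_sym qx) qy.
rewrite bigcup_mkcond; apply: countable_bigcupT_measurable => // t.
by case: ifP => _; [exact: measurable_ball_rV|exact: measurable0].
Qed.

Lemma closed_measurable_rV (F : set 'rV[R]_n) : closed F -> measurable F.
Proof.
move=> cF; rewrite -[F]setCK; apply: measurableC.
by apply: open_measurable_rV; rewrite openC.
Qed.

Lemma measurable_fun_rV d (T : measurableType d) m (f : T -> 'rV[R]_m) :
  (forall j, measurable_fun [set: T] (fun t => f t ord0 j)) ->
  measurable_fun [set: T] f.
Proof.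
move=> mf; rewrite (_ : f = @row_of_tuple _ R m \o
    (fun t => [tuple f t ord0 j | j < m])); last first.
  by apply/funext => t; apply/rowP => j; rewrite /= mxE tnth_mktuple.
apply: measurableT_comp; first exact: measurable_row_of_tuple.
apply/measurable_fun_tnthP => j.
by rewrite (_ : _ \o _ = fun t => f t ord0 j)//; apply/funext => t /=;
  rewrite tnth_mktuple.
Qed.

Lemma measurable_mulmx_rV m (A : 'M[R]_(n, m)) :
  measurable_fun setT (fun v : 'rV[R]_n => v *m A).
Proof.
apply: measurable_fun_rV => j; under eq_fun do rewrite mxE.
apply: measurable_sum => i; apply: measurable_funM => //.
exact: measurable_coord_rV.
Qed.

(** The projection is multiplication by a fixed matrix, and a compact set is closed in a Hausdorff
    space, hence measurable. *)
Lemma measurable_fov_indic (U : 'M[R]_n) (S : set 'rV[R]_n) :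
  compact S -> measurable_fun setT (fov_indic U S).
Proof.
move=> cS; apply: measurableT_comp; last exact: measurable_mulmx_rV.
apply: measurable_indic; apply: closed_measurable_rV.
by apply: compact_closed => //; exact: norm_hausdorff.
Qed.

End measurable_rV.

Lemma measurable_eq_fun d (T : measurableType d) (R : realType)
    (phi psi : T -> R) :
  measurable_fun setT phi -> measurable_fun setT psi ->
  measurable [set x | phi x = psi x].
Proof.
move=> mphi mpsi; rewrite (_ : [set _ | _] = (phi \- psi) @^-1` [set 0]).
  by rewrite -[X in measurable X]setTI; exact: measurable_funB.
by apply/seteqP; split=> x /=; [move=> ->; rewrite subrr|move/subr0_eq].
Qed.

(** * Tonelli, products and diagonals for power measures *)

Section power_measure.
Local Open Scope ereal_scope.
Context d (T : measurableType d) (R : realType).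
Variable mu : {sigma_finite_measure set T -> \bar R}.

Lemma integral_power_measureS n (f : n.+1.-tuple T -> \bar R) :
  measurable_fun setT f -> (forall t, 0 <= f t) ->
  \int[power_measure mu n.+1]_t f t =
  \int[mu]_x \int[power_measure mu n]_t f (tuple_cons (x, t)).
Proof.
move=> mf f0; have mfc : measurable_fun setT (f \o @tuple_cons _ T n).
  exact: measurableT_comp (@measurable_tuple_cons _ T n).
rewrite [LHS](@ge0_integral_pushforward _ _ _ _ _ _
  (@measurable_tuple_cons _ T n))//.
by rewrite preimage_setT fubini_tonelli1// => x; exact: f0.
Qed.

Lemma tnth_tuple_cons0 n (z : T * n.-tuple T) : tnth (tuple_cons z) ord0 = z.1.
Proof. by rewrite (tnth_nth z.1). Qed.

Lemma tnth_tuple_consS n (z : T * n.-tuple T) i :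
  tnth (tuple_cons z) (lift ord0 i) = tnth z.2 i.
Proof. by rewrite !(tnth_nth z.1). Qed.

Lemma measurable_prod_tnth n (g : 'I_n -> T -> R) :
  (forall i, measurable_fun setT (g i)) ->
  measurable_fun setT
    (fun t : n.-tuple T => (\prod_(i < n) g i (tnth t i))%R).
Proof.
move=> mg; apply: measurable_prod => i _.
by apply: measurableT_comp => //; exact: measurable_tnth.
Qed.

(** Induction on [n]: Tonelli isolates the first coordinate, and the integral over the others is a
    constant that factors out. Real values [c i] record that the one-variable integrals are
    finite. *)
Lemma integral_power_measure_prod n (g : 'I_n -> T -> R) (c : 'I_n -> R) :
  (forall i, measurable_fun setT (g i)) -> (forall i x, 0 <= g i x)%R ->
  (forall i, \int[mu]_x (g i x)%:E = (c i)%:E) ->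
  \int[power_measure mu n]_t (\prod_(i < n) g i (tnth t i))%:E =
  (\prod_(i < n) c i)%:E.
Proof.
elim: n g c => [|n IH] g c mg g0 gc.
  rewrite big_ord0 /=; under eq_integral do rewrite big_ord0.
  by rewrite integral_dirac// diracT mul1e.
rewrite integral_power_measureS; last 2 first.
  by apply/measurable_EFinP; exact: measurable_prod_tnth.
  by move=> t; rewrite lee_fin prodr_ge0.
pose c' := (\prod_(i < n) c (lift ord0 i))%R.
transitivity (\int[mu]_x ((g ord0 x)%:E * c'%:E)).
  apply: eq_integral => x _.
  rewrite -(IH (fun i => g (lift ord0 i)))// -ge0_integralZl//=; last 3 first.
  - apply/measurable_EFinP.
    exact: (measurable_prod_tnth (g := fun i => g (lift ord0 i))).
  - by move=> t _; rewrite lee_fin prodr_ge0.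
  - by rewrite lee_fin.
  apply: eq_integral => t _; rewrite big_ord_recl tnth_tuple_cons0 EFinM.
  by congr (_ * _%:E); apply: eq_bigr => i _; rewrite tnth_tuple_consS.
rewrite ge0_integralZr//; last 3 first.
- exact/measurable_EFinP.
- by move=> x _; rewrite lee_fin.
- rewrite lee_fin prodr_ge0// => i _.
  by rewrite -lee_fin -gc integral_ge0// => x _; rewrite lee_fin.
by rewrite gc big_ord_recl EFinM.
Qed.

(** With all coordinates but one fixed, the event is a level set of [phi], hence null. Comparing
    values of a real function makes the event measurable by subtraction. *)
Lemma power_measure_eq_coord (phi : T -> R) n (i j : 'I_n) :
  measurable_fun setT phi -> (forall a, mu (phi @^-1` [set a]) = 0) ->
  i != j ->
  power_measure mu n [set t | phi (tnth t i) = phi (tnth t j)] = 0.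
Proof.
move=> mphi phi0.
have mE0 m (l : 'I_m) : measurable
    [set z : T * m.-tuple T | phi z.1 = phi (tnth z.2 l)].
  apply: measurable_eq_fun; apply: measurableT_comp => //.
  exact: measurableT_comp (measurable_tnth l) measurable_snd.
have E0 m (l : 'I_m) :
    power_measure mu m.+1
      [set t | phi (tnth t ord0) = phi (tnth t (lift ord0 l))] = 0.
  rewrite -[LHS]/((mu \x power_measure mu m) _).
  rewrite (_ : _ @^-1` _ =
      [set z : T * m.-tuple T | phi z.1 = phi (tnth z.2 l)]); last first.
    by apply/seteqP; split=> z /=; rewrite tnth_tuple_cons0 tnth_tuple_consS.
  (* The product is computed in the other order, so that each section fixes the tail and leaves a
     level set of [phi] in the head. *)
  rewrite (product_measure_unique (m' := mu \x^ power_measure mu m)) //;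
    last 2 first.
  - by move=> A B mA mB; rewrite -product_measure2E.
  - exact: mE0.
  apply: integral0_eq => t _ /=.
  by rewrite -(phi0 (phi (tnth t l))) /ysection; congr (mu _);
    apply/seteqP; split=> x /=; rewrite inE.
elim: n i j => [[]//|n IH] i j.
case: (unliftP ord0 i) => [i'|] ->; case: (unliftP ord0 j) => [j'|] ->.
(* When both indices lie in the tail, every section at a fixed head is null by induction. *)
- rewrite (inj_eq (@lift_inj _ _)) => ij.
  rewrite -[LHS]/((mu \x power_measure mu n) _).
  apply: integral0_eq => x _ /=.
  rewrite -(IH _ _ ij) /xsection; congr (power_measure _ _ _).
  by apply/seteqP; split=> t /=; rewrite inE/= !tnth_tuple_consS.
- move=> _; rewrite -(E0 n i'); congr (power_measure _ _ _).
  by apply/seteqP; split=> t /= ->.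
- by move=> _; exact: E0.
- by rewrite eqxx.
Qed.

End power_measure.

Section ge0_null_integral.
Import HBNNSimple.

(* f need not be measurable: the integral is a supremum over simple functions. *)
Lemma ge0_null_integral d (T : measurableType d) (R : realType)
  (mu : {measure set T -> \bar R}) (N : set T) (f : T -> \bar R) :
  measurable N -> (mu N = 0)%E -> (forall x, 0 <= f x)%E ->
  (forall x, ~ N x -> f x = 0)%E -> (\int[mu]_x f x = 0)%E.
Proof.
move=> mN N0 f0 fN; rewrite ge0_integralTE//; apply/eqP; rewrite eq_le.
apply/andP; split; last first.
  by rewrite -(ge0_integralTE mu f0); exact: integral_ge0.
apply: ge_ereal_sup => /= _ [h hf <-].
(* The simple function [h] is measurable, so [N] can be removed from its domain of integration; off
   [N] it is squeezed between 0 and [f = 0]. *)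
rewrite -integralT_nnsfun (ge0_negligible_integral mN)//; last 2 first.
- exact: measurableT_comp.
- by move=> x _; rewrite lee_fin.
rewrite integral0_eq// => x [_ Nx]; apply/eqP; rewrite eq_le -{1}(fN _ Nx).
by rewrite lee_fin hf fun_ge0.
Qed.

End ge0_null_integral.

(** * Sums over countable types, tuples and finite sets *)

Section esum.
Local Open Scope ereal_scope.
Context {R : realType}.

(** Enumerating [I] by its codes gives access to the results on series, such as monotone
    convergence; integers that code no element contribute the default 0. *)
Lemma esum_countType (I : countType) (a : I -> \bar R) :
  (forall i, 0 <= a i) ->
  \esum_(i in setT) a i = \sum_(k <oo) oapp a 0 (pickle_inv k).
Proof.
move=> a0; rewrite nneseries_esumT; last by move=> k; case: pickle_inv.
transitivity (\esum_(k in range (@choice.pickle I)) oapp a 0 (pickle_inv k)).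
  rewrite esum_image.
    by apply: eq_esum => i _; rewrite pickleK_inv.
  by move=> i j _ _; exact: (pcan_inj pickleK_inv).
rewrite esum_mkcond; apply: eq_esum => k _; case: ifPn => //.
rewrite notin_setE => nk; case E : (pickle_inv k) => [i|]//=.
by case: nk; exists i => //; have := @pickle_invK I k; rewrite E.
Qed.

Lemma ge0_esumZl (I : countType) (c : R) (a : I -> \bar R) :
  (0 <= c)%R -> (forall i, 0 <= a i) ->
  \esum_(i in setT) (c%:E * a i) = c%:E * \esum_(i in setT) a i.
Proof.
move=> c0 a0; rewrite !esum_countType//; last by move=> i; rewrite mule_ge0.
rewrite -nneseriesZl; last by move=> k _; case: pickle_inv.
by apply: eq_eseriesr => k _; case: pickle_inv => //=; rewrite mule0.
Qed.

Lemma ge0_integral_esum d (T : measurableType d)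
    (mu : {measure set T -> \bar R}) (I : countType) (a : I -> T -> \bar R) :
  (forall i, measurable_fun setT (a i)) -> (forall i x, 0 <= a i x) ->
  \int[mu]_x (\esum_(i in setT) a i x) =
  \esum_(i in setT) \int[mu]_x a i x.
Proof.
move=> ma a0; rewrite esum_countType; last first.
  by move=> i; apply: integral_ge0.
under eq_integral do rewrite esum_countType//.
rewrite integral_nneseries//; last 2 first.
- by move=> k; case: (pickle_inv k) => [i|] //=.
- by move=> k x _; case: (pickle_inv k) => [i|] //=.
by apply: eq_eseriesr => k _; case: (pickle_inv k) => [i|]//=;
  rewrite integral0.
Qed.

Context {L : countType}.

(** A duplicate-free tuple amounts to its set of entries together with one of the [m!] orderings of
    that set. *)
Lemma esum_uniq_tuple (F : {fset L} -> \bar R) m : (forall I, 0 <= F I) ->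
  \esum_(l in [set: m.-tuple L])
    (if uniq l then F [fset a in (l : seq L)]%fset else 0) =
  (m`!%:R)%:E * \esum_(I in [set I : {fset L} | #|` I| = m]) F I.
Proof.
move=> F0; transitivity (\esum_(l in [set l : m.-tuple L | uniq l])
    F [fset a in (l : seq L)]%fset).
  rewrite [RHS]esum_mkcond; apply: eq_esum => l _.
  by rewrite mem_setE.
pose P (I : {fset L}) := [set` permutations (I : seq L)].
transitivity (\esum_(k in [set I : {fset L} | #|` I| = m] `*`` P) F k.1).
  rewrite (reindex_esum [set l : m.-tuple L | uniq l] _
    (fun l : m.-tuple L => ([fset a in (l : seq L)]%fset, l : seq L)))//.
  split.
  - move=> l /= ul; split=> /=.
      by rewrite card_fseq undup_id// size_tuple.
    rewrite /P/= mem_permutations uniq_perm// => [|x]; first exact: fset_uniq.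
    by rewrite in_fset.
  - by move=> l1 l2 _ _ [_]; exact: val_inj.
  - move=> [I s] [/= Im]; rewrite /P/= mem_permutations => sI.
    have sm : size s == m by rewrite (perm_size sI) -Im.
    exists (Tuple sm); first by rewrite /= (perm_uniq sI) fset_uniq.
    by congr (_, _); apply/fsetP => x; rewrite in_fset/= (perm_mem sI).
rewrite -(@esum_esum _ _ _ _ _ (fun I _ => F I))//.
(* The factor [m!] is spelled out as a finite sum of copies, which commutes with the outer sum. *)
transitivity (\esum_(I in [set I : {fset L} | #|` I| = m]) \sum_(j < m`!) F I).
  apply: eq_esum => I /= Im.
  rewrite esum_fset//; last exact: finite_seq.
  rewrite -fsbig_seq ?permutations_uniq// big_const_seq count_predT.
  by rewrite size_permutations ?fset_uniq// Im big_const_ord.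
by rewrite esum_sum// sumr_const card_ord mule_natl.
Qed.

(** Finite sets are partitioned by cardinality; starting the series at [n] loses only sets where [F]
    vanishes. *)
Lemma nneseries_esum_card (F : {fset L} -> \bar R) n : (forall I, 0 <= F I) ->
  (forall I, (#|` I| < n)%N -> F I = 0) ->
  \sum_(n <= m <oo) \esum_(I in [set I : {fset L} | #|` I| = m]) F I =
  \esum_(I in setT) F I.
Proof.
move=> F0 Fn; rewrite eseries_cond/= nneseries_esum; last first.
  by move=> m _; apply: esum_ge0 => I _; exact: F0.
rewrite (@esum_esum _ _ _ _ _ (fun _ I => F I))//.
rewrite (reindex_esum [set I : {fset L} | n <= #|` I|]%N _
  (fun I : {fset L} => (#|` I|, I))).
  rewrite esum_mkcond; apply: eq_esum => I _; case: ifPn => //.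
  by rewrite notin_setE => /negP; rewrite -ltnNge => /Fn ->.
split.
- by move=> I.
- by move=> I J _ _ [].
- by move=> [m I] [/= nm mI]; exists I; rewrite ?mI.
Qed.

End esum.

(** * Labeled sets indexed by their labels *)

Section labeled_set.
Context {R : realType} {d : nat} {L : countType}.
Local Notation X := 'rV[R]_d.
Implicit Types (I B : {fset L}) (one : X -> R).

(** Merging the inside and outside factors into one product over [I] gives the shape that integrates
    coordinate by coordinate; read backwards, it separates them again. *)
Lemma big_fset_if I B (f g : L -> R) : (B `<=` I)%fset ->
  \prod_(a <- I) (if a \in B then f a else g a) =
  (\prod_(a <- B) f a) * \prod_(a <- (I `\` B)%fset) g a.
Proof.
move=> BI; rewrite (big_fsetID _ (mem B))/=.
have -> : [fset a in I | a \in B]%fset = B.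
  by apply/fsetP => a; rewrite !inE/= andbC; case: (boolP (a \in B)) => //
    /(fsubsetP BI).
have -> : [fset a in I | a \notin B]%fset = (I `\` B)%fset.
  by apply/fsetP => a; rewrite !inE/= andbC.
congr (_ * _); apply: eq_big_seq => a; first by move=> ->.
by rewrite inE => /andP[/negbTE ->].
Qed.

Lemma fpowerset_imfset (K : choiceType) (s : L -> K) I :
  fpowerset (s @` I)%fset =
  [fset (s @` B)%fset | B : {fset L} in fpowerset I]%fset.
Proof.
apply/fsetP => C; rewrite fpowersetE; apply/idP/imfsetP => /= [CI|[B]].
  exists [fset a in I | s a \in C]%fset.
    by rewrite fpowersetE; apply/fsubsetP => a; rewrite !inE => /andP[].
  apply/fsetP => z; apply/idP/imfsetP => /= [zC|[a + ->]].
    have /imfsetP[/= a aI za] := fsubsetP CI _ zC.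
    by exists a => //; rewrite !inE/= aI -za.
  by rewrite !inE => /andP[].
rewrite fpowersetE => /fsubsetP BI ->; apply/fsubsetP => _ /imfsetP[a /= aB ->].
by apply/imfsetP; exists a => //=; exact: BI.
Qed.

Lemma mexp_imfset (T K : choiceType) (h : K -> R) (s : T -> K) (B : {fset T}) :
  injective s -> mexp h (s @` B)%fset = \prod_(a <- B) h (s a).
Proof. by move=> sI; rewrite /mexp big_imfset//= => a b _ _ /sI. Qed.

Lemma fov_card_cond_imfset one n (s : L -> X * L) I : injective s ->
  fov_card_cond one n (s @` I)%fset = \sum_(B <- fpowerset I | #|` B| == n)
    \prod_(a <- I) (if a \in B then one (s a).1 else 1 - one (s a).1).
Proof.
(* The cardinality filter moves into the summand during the reindexing by label subsets and is
   restored afterwards. *)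
move=> sI; rewrite /fov_card_cond big_mkcond fpowerset_imfset.
rewrite big_imfset/=; last first.
  move=> B C _ _ BC; apply/fsetP => a.
  have sE (D : {fset L}) : (s a \in (s @` D)%fset) = (a \in D).
    by rewrite mem_imfset.
  by rewrite -!sE BC.
rewrite -big_mkcond/=.
rewrite (eq_bigl (fun B => #|` B| == n)); last by move=> B; rewrite card_imfset.
rewrite big_seq_cond [RHS]big_seq_cond; apply: eq_bigr => B.
rewrite fpowersetE => /andP[BI _]; rewrite big_fset_if// mexp_imfset//.
congr (_ * _); rewrite -(mexp_imfset (fun z => 1 - one z.1) _ sI).
congr (mexp _ _); apply/fsetP => z.
rewrite !inE; apply/andP/imfsetP => /= [[zB /imfsetP[/= a aI za]]|[a + ->]].
  by exists a; rewrite // !inE aI andbT; move: zB; rewrite za mem_imfset.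
by rewrite !inE !mem_imfset// => /andP[].
Qed.

(* The element of labeled_set x l with label a; the junk point 0 is used when a
   is not in l. *)
Definition labeled_point m (l : seq L) (x : m.-tuple X) (a : L) : X * L :=
  (nth 0 x (index a l), a).

Lemma labeled_point_inj m (l : seq L) (x : m.-tuple X) :
  injective (labeled_point l x).
Proof. by move=> a b []. Qed.

Lemma labeled_point_tnth m (l : m.-tuple L) (x : m.-tuple X) i : uniq l ->
  labeled_point l x (tnth l i) = (tnth x i, tnth l i).
Proof.
move=> ul; rewrite /labeled_point (tnth_nth 0 x); congr (nth _ _ _, _).
by rewrite {1}(tnth_nth (tnth l i)) index_uniq ?size_tuple.
Qed.

(** With distinct labels the set is an injective image of its label set, so sums over its subsets
    become sums over label subsets that do not depend on [x]. *)
Lemma labeled_set_point m (l : m.-tuple L) (x : m.-tuple X) : uniq l ->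
  labeled_set x l = (labeled_point l x @` [fset a in (l : seq L)])%fset.
Proof.
move=> ul; apply/fsetP => z; apply/imfsetP/imfsetP => /= [[i _ ->]|[a + ->]].
  by exists (tnth l i); rewrite ?labeled_point_tnth// in_fset/= mem_tnth.
by rewrite in_fset/= => /tnthP[i ->]; exists i; rewrite ?labeled_point_tnth.
Qed.

Lemma big_fset_tuple m (l : m.-tuple L) (h : L -> R) : uniq l ->
  \prod_(a <- [fset a in (l : seq L)]%fset) h a = \prod_(i < m) h (tnth l i).
Proof.
move=> ul; transitivity (\prod_(a <- l) h a); last by rewrite big_tuple.
apply: perm_big; apply: uniq_perm => // a.
by rewrite in_fset.
Qed.

Lemma labels_point m (l : seq L) (x : m.-tuple X) I :
  labels (labeled_point l x @` I)%fset = I.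
Proof.
rewrite /labels; apply/fsetP => a; apply/imfsetP/idP => /=.
  by case=> _ /imfsetP[b /= bI ->] ->.
by move=> aI; exists (labeled_point l x a) => //; apply/imfsetP; exists a.
Qed.

(** Two different elements share a label, so the label projection is not injective on the set and
    lowers its cardinality. *)
Lemma distinct_label_collision m (l : m.-tuple L) (x : m.-tuple X) i j :
  tnth l i = tnth l j -> tnth x i != tnth x j ->
  distinct_label (labeled_set x l) = 0.
Proof.
move=> lij /eqP xij; rewrite /distinct_label eq_sym.
have mz k : (tnth x k, tnth l k) \in labeled_set x l by apply/imfsetP; exists k.
case: card_in_imfsetP => // /(_ _ _ (mz i) (mz j) lij) [] // /xij.
Qed.

End labeled_set.

(** * Null hyperplanes and one-object integrals *)

Lemma lebesgue_rV_coord_null (R : realType) (d : nat) (hd : (0 < d)%N) (a : R) :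
  lebesgue_rV R d [set v | v ord0 (Ordinal hd) = a] = 0%E.
Proof.
case: d hd => // d hd; rewrite (_ : Ordinal hd = ord0); last exact: val_inj.
pose nu := power_measure (@lebesgue_measure R) d.
rewrite -[LHS]/((lebesgue_measure \x nu)%E _).
(* The hyperplane is a singleton times the space of the remaining coordinates; even if the latter
   has infinite measure, [0 * +oo = 0] in [\bar R]. *)
rewrite (_ : _ @^-1` _ = [set a] `*` setT); last first.
  by apply/seteqP; split=> -[x t] /=; rewrite mxE tnth_tuple_cons0//= => -[].
rewrite product_measure1E// [X in (X * _)%E](_ : _ = 0%E) ?mul0e//.
exact: (lebesgue_measure_set1 a).
Qed.

Section inner.
Context {R : realType} {d : nat}.
Local Notation X := 'rV[R]_d.

(** [inner] truncates an extended real to a real; nothing is lost, since the integral is at most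
    that of [g], which is 1. *)
Lemma EFin_inner (f g : X -> R) : measurable_fun setT f ->
  (forall x, 0 <= f x <= 1) -> is_pdf g ->
  (\int[lebesgue_rV R d]_x (f x * g x)%:E)%E = (inner f g)%:E.
Proof.
move=> mf f01 [mg g0 g1]; rewrite /inner /Rintegral fineK//.
have fg0 x : (0 <= (f x * g x)%:E)%E.
  by rewrite lee_fin mulr_ge0//; case/andP: (f01 x).
rewrite ge0_fin_numE ?integral_ge0//; apply: (@le_lt_trans _ _ 1%E).
  rewrite -g1; apply: ge0_le_integral => //.
  - by apply/measurable_EFinP; exact: measurable_funM.
  - exact/measurable_EFinP.
  - move=> x _; rewrite lee_fin ler_piMl//; by case/andP: (f01 x).
exact: ltry.
Qed.

Lemma inner_ge0 (f g : X -> R) : (forall x, 0 <= f x) -> (forall x, 0 <= g x) ->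
  0 <= inner f g.
Proof. by move=> f0 g0; apply: Rintegral_ge0 => x _; exact: mulr_ge0. Qed.

End inner.

(** * The set integral of the GLMB density, for any measurable [one] with values in [0, 1] *)

Section glmb.
Context {R : realType} {d : nat} {L Xi : countType}.
Local Notation X := 'rV[R]_d.
Variables (one : X -> R) (w : Xi -> {fset L} -> R) (p : Xi -> X * L -> R).
Hypothesis mone : measurable_fun setT one.
Hypothesis one01 : forall x, 0 <= one x <= 1.
Hypothesis w_ge0 : forall xi I, 0 <= w xi I.
Hypothesis p_pdf : forall xi l, is_pdf (fun x => p xi (x, l)).
Implicit Types (xi : Xi) (I B : {fset L}).
Local Notation mu := (lebesgue_rV R d).

Definition fov_weight xi I1 I2 : R :=
  (\prod_(l <- I1) inner one (fun x => p xi (x, l))) *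
  \prod_(l <- I2) inner (fun x => 1 - one x) (fun x => p xi (x, l)).

(** Under the section hypotheses the sum is a Poisson binomial probability: [n] successes among
    independent trials indexed by [I], with success probabilities [inner one p]. *)
Definition glmb_fov_card n xi I : R :=
  w xi I * \sum_(B <- fpowerset I | #|` B| == n) fov_weight xi B (I `\` B)%fset.

Let one_ge0 x : 0 <= one x. Proof. by case/andP: (one01 x). Qed.

Let one_le1 x : 0 <= 1 - one x.
Proof. by rewrite subr_ge0; case/andP: (one01 x). Qed.

Let p_ge0 xi z : 0 <= p xi z.
Proof. by case: z => x l; case: (p_pdf xi l) => _ + _; exact. Qed.

Let fov_weight_ge0 xi I1 I2 : 0 <= fov_weight xi I1 I2.
Proof. by rewrite mulr_ge0// prodr_ge0// => l _; exact: inner_ge0. Qed.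

Lemma glmb_density_ge0 A : (0 <= glmb_density w p A)%E.
Proof.
rewrite mule_ge0 ?lee_fin ?ler0n//; apply: esum_ge0 => xi _.
by rewrite mule_ge0// lee_fin// prodr_ge0.
Qed.

Lemma fov_card_cond_ge0 n (A : {fset X * L}) : 0 <= fov_card_cond one n A.
Proof.
by apply: sumr_ge0 => B _; rewrite mulr_ge0// prodr_ge0.
Qed.

Lemma glmb_density_point m (l : seq L) (x : m.-tuple X) I :
  glmb_density w p (labeled_point l x @` I)%fset =
  (\esum_(xi in setT) (w xi I *
    \prod_(a <- I) p xi (labeled_point l x a))%:E)%E.
Proof.
rewrite /glmb_density labels_point /distinct_label labels_point.
rewrite card_imfset/=; last exact: labeled_point_inj.
rewrite eqxx mul1e; apply: eq_esum => xi _.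
by rewrite mexp_imfset//; exact: labeled_point_inj.
Qed.

(** Everything is non-negative, so the integral passes through the sums over [xi] and [B]; each
    remaining term is a product of functions of single coordinates. *)
Lemma integral_fov_glmb_uniq n m (l : m.-tuple L) : uniq l ->
  (\int[power_measure mu m]_x ((fov_card_cond one n (labeled_set x l))%:E *
     glmb_density w p (labeled_set x l)) =
   \esum_(xi in setT) (glmb_fov_card n xi [fset a in (l : seq L)]%fset)%:E)%E.
Proof.
move=> ul; set I := [fset a in (l : seq L)]%fset.
pose h B xi (i : 'I_m) y := (if tnth l i \in B then one y else 1 - one y) *
  p xi (y, tnth l i).
have h0 B xi i y : 0 <= h B xi i y by rewrite mulr_ge0//; case: ifP.
have mh B xi i : measurable_fun setT (h B xi i).
  have [mp _ _] := p_pdf xi (tnth l i); apply: measurable_funM => //.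
  by case: (tnth l i \in B) => //; exact: measurable_funB.
have mH B xi : measurable_fun setT
    (fun x : m.-tuple X => \prod_(i < m) h B xi i (tnth x i)).
  exact: measurable_prod_tnth.
have mS xi : measurable_fun setT (fun x : m.-tuple X =>
    (\sum_(B <- fpowerset I | #|` B| == n)
       (\prod_(i < m) h B xi i (tnth x i))%:E)%E).
  (* The condition on [B] is absorbed into the list, since the measurability of sums is applied to
     an unconditional sum. *)
  under eq_fun do rewrite -big_filter.
  by apply: emeasurable_sum => B; exact/measurable_EFinP.
have sum0 xi (x : m.-tuple X) : 0 <= \sum_(B <- fpowerset I | #|` B| == n)
     \prod_(i < m) h B xi i (tnth x i).
  by apply: sumr_ge0 => B _; exact: prodr_ge0.
have integrandE x : ((fov_card_cond one n (labeled_set x l))%:E *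
     glmb_density w p (labeled_set x l) =
   \esum_(xi in setT) ((w xi I)%:E *
     \sum_(B <- fpowerset I | #|` B| == n)
       (\prod_(i < m) h B xi i (tnth x i))%:E))%E.
  rewrite labeled_set_point// glmb_density_point -ge0_esumZl; last 2 first.
  - exact: fov_card_cond_ge0.
  - by move=> xi; rewrite lee_fin mulr_ge0// prodr_ge0.
  apply: eq_esum => xi _; rewrite sumEFin -!EFinM; congr (_%:E).
  rewrite mulrCA; congr (_ * _).
  rewrite fov_card_cond_imfset; last exact: labeled_point_inj.
  rewrite mulr_suml; apply: eq_bigr => B _.
  rewrite -big_split/= big_fset_tuple//; apply: eq_bigr => i _.
  by have zE := labeled_point_tnth x i ul; rewrite zE; case: zE => ->.
under eq_integral do rewrite integrandE.
rewrite ge0_integral_esum; last 2 first.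
- by move=> xi; exact: measurable_funeM.
- by move=> xi x; rewrite sumEFin -EFinM lee_fin mulr_ge0.
apply: eq_esum => xi _; rewrite ge0_integralZl//; last 2 first.
- by move=> x _; rewrite sumEFin lee_fin.
- by rewrite lee_fin.
rewrite /glmb_fov_card EFinM; congr (_ * _)%E; rewrite -sumEFin.
under eq_integral do rewrite -big_filter.
rewrite ge0_integral_sum//; last 2 first.
- by move=> B; exact/measurable_EFinP.
- by move=> B x _; rewrite lee_fin prodr_ge0.
rewrite big_filter big_seq_cond [RHS]big_seq_cond; apply: eq_bigr => B.
rewrite fpowersetE => /andP[BI _].
rewrite (@integral_power_measure_prod _ _ _ _ _ _ (fun i => if tnth l i \in B
   then inner one (fun x => p xi (x, tnth l i))
   else inner (fun x => 1 - one x) (fun x => p xi (x, tnth l i))))//.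
  by rewrite /fov_weight -big_fset_if// big_fset_tuple.
move=> i; rewrite /h; case: ifP => _; rewrite EFin_inner//.
  exact: measurable_funB.
by move=> x; rewrite one_le1 gerBl one_ge0.
Qed.

Lemma integral_fov_glmb_nuniq n m (l : m.-tuple L) : (0 < d)%N -> ~~ uniq l ->
  (\int[power_measure mu m]_x ((fov_card_cond one n (labeled_set x l))%:E *
     glmb_density w p (labeled_set x l)) = 0)%E.
Proof.
move=> hd nul.
have /injectivePn[i [j ij lij]] : ~~ injectiveb (tnth l).
  by apply: contra nul => /injectiveP/tuple_uniqP.
pose phi (v : X) : R := v ord0 (Ordinal hd).
have mphi : measurable_fun setT phi by exact: measurable_coord_rV.
(* The collision of points [i] and [j] is enlarged to equality of their first coordinates, which is
   measurable and still null. *)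
pose N := [set x : m.-tuple X | phi (tnth x i) = phi (tnth x j)].
apply: (@ge0_null_integral _ _ _ _ N).
- apply: (@measurable_eq_fun _ _ _ (phi \o (fun x => tnth x i))
    (phi \o (fun x => tnth x j)));
    apply: measurableT_comp => //; exact: measurable_tnth.
- by apply: power_measure_eq_coord => // a; exact: lebesgue_rV_coord_null.
- by move=> x; rewrite mule_ge0 ?glmb_density_ge0// lee_fin fov_card_cond_ge0.
- move=> x Nx; rewrite /glmb_density (distinct_label_collision lij).
    by rewrite mul0e mule0.
  by apply/eqP => xij; apply: Nx; rewrite /N/= xij.
Qed.

Let glmb_fov_card_ge0 n xi I : 0 <= glmb_fov_card n xi I.
Proof. by rewrite mulr_ge0// sumr_ge0. Qed.

Lemma glmb_fov_card0 n xi I : (#|` I| < n)%N -> glmb_fov_card n xi I = 0.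
Proof.
move=> In; rewrite /glmb_fov_card big_seq_cond big1 ?mulr0// => B.
rewrite fpowersetE => /andP[/fsubset_leq_card BI /eqP Bn].
by move: In; rewrite ltnNge -Bn BI.
Qed.

(** The filter becomes a 0/1 factor and the finite sum an [\esum], ready to be merged with the sums
    over [I] and [xi]. *)
Lemma glmb_fov_card_esum n xi I : (glmb_fov_card n xi I)%:E =
  (\esum_(B in [set B | B `<=` I]%fset)
    (w xi I * (#|` B| == n)%:R * fov_weight xi B (I `\` B)%fset)%:E)%E.
Proof.
rewrite (_ : [set B | _] = [set` fpowerset I]); last first.
  by apply/seteqP; split=> B /=; rewrite fpowersetE.
rewrite esum_fset//; last first.
  by move=> B _; rewrite lee_fin mulr_ge0// mulr_ge0.
rewrite -fsbig_seq ?fset_uniq// sumEFin; congr (_%:E).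
rewrite /glmb_fov_card mulr_sumr big_mkcond; apply: eq_bigr => B _.
by case: ifP; rewrite ?mulr1// mulr0 mul0r.
Qed.

Lemma fov_card_glmb n : (0 < d)%N ->
  fov_card one (glmb_density w p) n =
  (\esum_(t in [set t : Xi * ({fset L} * {fset L}) |
                 fdisjoint t.2.1 t.2.2])
     (w t.1 (t.2.1 `|` t.2.2)%fset * (#|` t.2.1| == n)%:R *
      fov_weight t.1 t.2.1 t.2.2)%:E)%E.
Proof.
move=> hd.
pose F I := (\esum_(xi in setT) (glmb_fov_card n xi I)%:E)%E.
have F0 I : (0 <= F I)%E by apply: esum_ge0 => xi _; rewrite lee_fin.
transitivity (\esum_(I in setT) F I)%E.
  rewrite -(@nneseries_esum_card _ _ F n)//; last first.
    by move=> I In; apply: esum1 => xi _; rewrite glmb_fov_card0.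
  apply: eq_eseriesr => m _.
  (* Tuples with repeated labels contribute 0; the others yield the factor [m!] that cancels the
     normalisation. *)
  transitivity ((m`!%:R^-1)%:E * ((m`!%:R)%:E *
      \esum_(I in [set I : {fset L} | #|` I| = m]) F I))%E.
    congr (_ * _)%E; rewrite -esum_uniq_tuple//; apply: eq_esum => l _.
    by case: ifPn => ul; [exact: integral_fov_glmb_uniq|
      exact: integral_fov_glmb_nuniq].
  by rewrite muleA -EFinM mulVf ?mul1e// pnatr_eq0 -lt0n fact_gt0.
pose sub I := [set B : {fset L} | B `<=` I]%fset.
pose G xi I1 I2 : \bar R :=
  (w xi (I1 `|` I2)%fset * (#|` I1| == n)%:R * fov_weight xi I1 I2)%:E.
have UD I B : (B `<=` I)%fset -> (B `|` (I `\` B))%fset = I.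
  by move=> BI; rewrite fsetUDl fsetDv fsetD0; exact/fsetUidPr.
have G0 xi I1 I2 : (0 <= G xi I1 I2)%E by rewrite lee_fin mulr_ge0// mulr_ge0.
transitivity (\esum_(I in setT) \esum_(xi in setT) \esum_(B in sub I)
    G xi B (I `\` B)%fset)%E.
  apply: eq_esum => I _; apply: eq_esum => xi _.
  rewrite glmb_fov_card_esum; apply: eq_esum => B /= BI.
  by rewrite /G UD.
under eq_esum => I _.
  rewrite (@esum_esum _ _ _ _ (fun=> sub I)
    (fun xi B => G xi B (I `\` B)%fset))//.
  over.
rewrite (@esum_esum _ _ _ _ (fun I => setT `*`` (fun=> sub I))
  (fun I k => G k.1 k.2 (I `\` k.2)%fset))//.
(* The triple [(I, (xi, B))] with [B] inside [I] corresponds to the disjoint pair [B], [I \ B]; the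
   inverse recovers [I] as their union. *)
rewrite (reindex_esum (setT `*`` (fun I => setT `*`` (fun=> sub I))) _
  (fun k : {fset L} * (Xi * {fset L}) =>
    (k.2.1, (k.2.2, k.1 `\` k.2.2)%fset)))//.
split.
- move=> [I [xi B]] _ /=; apply/fdisjointP => a aB.
  by rewrite in_fsetD aB.
- move=> [I [xi B]] [J [xi' C]]; rewrite !inE => -[_ [_ /= BI]] [_ [_ /= CJ]].
  by move=> [<- BC]; rewrite -BC in CJ * => IJ; rewrite -(UD _ _ BI) IJ UD.
- move=> [xi [I1 I2]] /= I12; exists ((I1 `|` I2)%fset, (xi, I1)).
    by split=> //; split=> //; exact: fsubsetUl.
  rewrite /= fsetDUl fsetDv fset0U; congr (_, (_, _)).
  by apply/fsetDidPl; rewrite fdisjoint_sym.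
Qed.

End glmb.

Theorem proposition4 (R : realType) (d : nat) (hd : (0 < d)%N)
    (Xp : 'M[R]_d) (S : set 'rV[R]_d) (S_compact : compact S)
    (S_sub : S `<=` [set s | (s <= Xp)%MS])
    (L Xi : countType)
    (w : Xi -> {fset L} -> R) (p : Xi -> 'rV[R]_d * L -> R)
    (w_ge0 : forall xi I, 0 <= w xi I)
    (w_sum1 : (\esum_(t in [set: {fset L} * Xi]) (w t.2 t.1)%:E = 1)%E)
    (p_pdf : forall xi l, is_pdf (fun x => p xi (x, l)))
    (n : nat) :
  fov_card (fov_indic Xp S) (glmb_density w p) n =
  (\esum_(t in [set t : Xi * ({fset L} * {fset L}) |
                 fdisjoint t.2.1 t.2.2])
     let: (xi, (I1, I2)) := t in
     (w xi (I1 `|` I2)%fset * (#|` I1| == n)%:R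
      * (\prod_(l <- I1) inner (fov_indic Xp S) (fun x => p xi (x, l)))
      * (\prod_(l <- I2)
           inner (fun x => 1 - fov_indic Xp S x) (fun x => p xi (x, l))))%R%:E)%E.
Proof.
have mone := measurable_fov_indic Xp S_compact.
have one01 x : 0 <= fov_indic Xp S x <= 1.
  by rewrite /fov_indic indicE ler0n lern1 leq_b1.
rewrite (fov_card_glmb mone one01 w_ge0 p_pdf n hd).
by apply: eq_esum => -[xi [I1 I2]] _; rewrite /fov_weight mulrA.
Qed.
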